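(* Let $\mathbb{X}$ be a metrizable topological space with its Borel $\sigma$-algebra, and let $\mathbb{Y}$ be a measurable space whose $\sigma$-algebra is countably generated and contains all singletons. Let $h\colon\mathbb{X}\to\mathbb{Y}$ be measurable and let $\mu$ be a $\sigma$-finite Radon measure on $\mathbb{X}$ such that $h_\star\mu$ is $\sigma$-finite. Let $X\subset\mathbb{X}$ be measurable. Then, for $h_\star\mu$-almost every $y\in\mathbb{Y}$, $$\mu^h(\,\cdot\mid y)\big|_X=\mu^h(X\mid y)\,(\mu|_X)^h(\,\cdot\mid y).$$
   Context: Disintegration: given a measurable map $h\colon\mathbb{X}\to\mathbb{Y}$ and a measure $\mu$ on $\mathbb{X}$, a disintegration of $\mu$ with respect to $h$ is a map $(A,y)\mapsto\mu^h(A\mid y)\in[0,\infty]$ such that $\mu^h(\,\cdot\mid y)$ is a measure on $\mathbb{X}$ for all $y\in\mathbb{Y}$, $y\mapsto\mu^h(A\mid y)$ is measurable for every measurable $A\subset\mathbb{X}$, (i) $\mu^h(\mathbb{X}\setminus h^{-1}(\{y\})\mid y)=0$, and (ii) $\mu(A)=\int_{\mathbb{Y}}\mu^h(A\mid y)\,h_\star\mu(dy)$ for every measurable $A$, where $h_\star\mu$ is the pushforward. Under the assumptions here it exists and is unique up to $h_\star\mu$-null sets of $y$. For a measure $\rho$ on $\mathbb{X}$, $\rho|_X$ is its measure-theoretic restriction to the measurable subsets of $X$, and $(\mu|_X)^h$ is the disintegration of $\mu|_X$ (a measure on the space $X$) with respect to $h|_X\colon X\to\mathbb{Y}$. The convention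 $0\cdot\infty=0$ is used. *)

(* Defs.v *)
From HB Require Import structures.
From mathcomp Require Import all_boot all_order all_algebra.
From mathcomp Require Import all_classical all_reals all_analysis.
From mathcomp Require Import measurable_realfun.

Set Implicit Arguments.
Unset Strict Implicit.
Unset Printing Implicit Defensive.

Import Order.TTheory GRing.Theory Num.Theory.
Import numFieldNormedType.Exports.

Local Open Scope classical_set_scope.
Local Open Scope ring_scope.

Definition metrizable (R : realType) (T : topologicalType) : Prop :=
  exists dist : T -> T -> R,
    [/\ forall x y, 0 <= dist x y,
        forall x y, dist x y = 0 <-> x = y,
        forall x y, dist x y = dist y x,
        forall x y z, dist x z <= dist x y + dist y z &
        forall (x : T) (A : set T), nbhs x A <->
          exists2 e : R, 0 < e & [set y | dist x y < e] `<=` A].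

Definition borel (T : ptopologicalType) := g_sigma_algebraType (@open T).

(* On a metrizable space, finiteness on compact sets may equivalently be
   replaced by local finiteness, given inner regularity. *)
Definition radon (R : realType) (T : ptopologicalType)
    (mu : {measure set (borel T) -> \bar R}) : Prop :=
  (forall K : set T, compact K -> (mu K < +oo)%E) /\
  (forall A : set (borel T), measurable A ->
    mu A = ereal_sup [set mu K | K in [set K : set T | compact K /\ K `<=` A]]).

Definition countably_generated d (Y : measurableType d) : Prop :=
  exists2 G : set (set Y), countable G & @measurable d Y = <<s G >>.

(* A measure on a subset [X] of [T], seen as a measurable space of its own, is
   a measure on the sigma-ring of the measurable sets of [T] included in [X].
   The subtype of the elements of [X] is not used because measurable types are
   pointed whereas [X] may be empty. *)
Definition restrType (T : Type) (X : set T) : Type := T.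

Definition restr_display (d : measure_display) : measure_display.
Proof. exact: d. Qed.

Section restrType_sigma_ring.
Context d (T : measurableType d) (X : set T).

Definition restr_measurable : set (set (restrType X)) :=
  [set A | @measurable d T A /\ A `<=` X].

Let restr_measurable0 : restr_measurable set0.
Proof. by split; [exact: measurable0|exact: sub0set]. Qed.

Let restr_measurableD : setD_closed restr_measurable.
Proof.
move=> A B [mA AX] [mB _]; split; first exact: (@measurableD _ T).
by move=> x [/AX].
Qed.

Let restr_bigcup (F : (set (restrType X))^nat) :
  (forall i, restr_measurable (F i)) -> restr_measurable (\bigcup_i F i).
Proof.
move=> mF; split.
  by apply: (@bigcupT_measurable _ T) => i; have [] := mF i.
by move=> x [i _ Fix]; have [_] := mF i; apply.
Qed.

HB.instance Definition _ := Pointed.copy (restrType X) T.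
HB.instance Definition _ := @isSigmaRing.Build (restr_display d)
  (restrType X) restr_measurable restr_measurable0 restr_measurableD
  restr_bigcup.

End restrType_sigma_ring.

Definition restrict_measure d (T : measurableType d) (R : realType)
  (mu : {measure set T -> \bar R}) (X : set T) : set (restrType X) -> \bar R :=
  mu.

Section restrict_measure_measure.
Context d (T : measurableType d) (R : realType).
Variables (mu : {measure set T -> \bar R}) (X : set T).

Let restrict0 : restrict_measure mu (X := X) set0 = 0%E.
Proof. exact: (measure0 mu). Qed.

Let restrict_ge0 (A : set (restrType X)) : (0 <= restrict_measure mu A)%E.
Proof. exact: (measure_ge0 mu A). Qed.

Let restrict_sigma_additive : semi_sigma_additive (restrict_measure mu (X := X)).
Proof.
move=> F mF tF [mUF _]; apply: (@measure_semi_sigma_additive _ T _ mu F) => //.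
by move=> i; have [] := mF i.
Qed.

HB.instance Definition _ := isMeasure.Build _ (restrType X) R
  (restrict_measure mu (X := X))
  restrict0 restrict_ge0 restrict_sigma_additive.

End restrict_measure_measure.

Definition pushforward_on d d' (T : sigmaRingType d) (Y : measurableType d')
    (R : realType) (D : set T) (mu : set T -> \bar R) (h : T -> Y) :
    set Y -> \bar R :=
  fun B => mu (D `&` h @^-1` B).

(* [D] is the underlying space, i.e., the greatest measurable set: [setT] when
   [T] is a measurable type, [X] when [T] is [restrType X]. Only the values of
   [h] on [D] matter. *)
Definition is_disintegration d d' (T : sigmaRingType d) (Y : measurableType d')
    (R : realType) (D : set T) (h : T -> Y) (mu : {measure set T -> \bar R})
    (k : Y -> {measure set T -> \bar R}) : Prop :=
  [/\ forall A, measurable A -> measurable_fun [set: Y] (fun y => k y A),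
      forall y, k y (D `\` h @^-1` [set y]) = 0%E &
      forall A, measurable A ->
        mu A = (\int[pushforward_on D mu h]_y k y A)%E].

(* Main.v *)
(* Write nu and nu_X for the pushforwards of mu and mu|_X by h. Testing both
   disintegrations on A `&` h^-1(E) with A `<=` X gives
     \int_E mu^h(A|y) dnu = \int_E (mu|_X)^h(A|y) dnu_X
   and A = X shows dnu_X = mu^h(X|y) dnu, so the two sides of the theorem agree
   on a fixed A for nu-almost every y. To get one null set for all A, use that
   a sigma-finite Radon measure is carried by a sigma-compact set L, and that
   the traces on L of the Borel sets of a metrizable space are generated by a
   countable pi-system; since mu^h(.|y) is almost surely a probability measure,
   agreement on this pi-system forces agreement on all Borel subsets of L. *)

Require Import Defs.
From HB Require Import structures.
From mathcomp Require Import all_boot all_order all_algebra.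
From mathcomp Require Import all_classical all_reals all_analysis.
From mathcomp Require Import measurable_realfun.

Set Implicit Arguments.
Unset Strict Implicit.
Unset Printing Implicit Defensive.

Import Order.TTheory GRing.Theory Num.Theory.
Import numFieldNormedType.Exports.

Local Open Scope classical_set_scope.
Local Open Scope ring_scope.

(** * Almost-everywhere equality, densities and uniqueness of measures *)

Section measure_lemmas.
Local Open Scope ereal_scope.

Lemma ae_forall_countable d (T : sigmaRingType d) (R : realType)
    (mu : {measure set T -> \bar R}) (I : countType) (P : I -> T -> Prop) :
  (forall i, \forall x \ae mu, P i x) -> \forall x \ae mu, forall i, P i x.
Proof.
move=> aeP.
have : \forall x \ae mu, forall n, oapp (P ^~ x) True (unpickle n).
  by apply: ae_foralln => n; case: unpickle => [i|] /=; [exact: aeP|exact: aeW].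
by apply: filterS => x Px i; have := Px (pickle i); rewrite pickleK.
Qed.

(** Equality of integrals forces equality almost everywhere for an integrable function, and [f] is
    integrable on each [F n]; the countably many null sets are then united. *)
Lemma ge0_integral_ae_eq d (T : measurableType d) (R : realType)
    (mu : {measure set T -> \bar R}) (F : (set T)^nat) (f g : T -> \bar R) :
  \bigcup_n F n = setT -> (forall n, measurable (F n)) ->
  (forall x, 0 <= f x) ->
  measurable_fun setT f -> measurable_fun setT g ->
  (forall n, \int[mu]_(x in F n) f x < +oo) ->
  (forall E, measurable E ->
    \int[mu]_(x in E) f x = \int[mu]_(x in E) g x) ->
  \forall x \ae mu, f x = g x.
Proof.
move=> FT mF f0 mf mg ffin fg.
have : \forall x \ae mu, forall n, F n x -> f x = g x.
  apply: ae_foralln => n; apply: integral_ae_eq => //.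
  - apply/integrableP; split; first exact: measurable_funTS.
    by under eq_integral do rewrite gee0_abs//; exact: ffin.
  - exact: measurable_funTS.
  - by move=> E _; exact: fg.
apply: filterS => x fgx.
have [n _ Fnx] : (\bigcup_n F n) x by rewrite FT.
exact: fgx Fnx.
Qed.

Import HBNNSimple.

(** On a level set of a simple function the formula is the density hypothesis itself; monotone
    convergence carries it over to [f]. *)
Lemma ge0_integral_density d (T : measurableType d) (R : realType)
    (mu nu : {measure set T -> \bar R}) (f g : T -> \bar R) :
  measurable_fun setT f -> measurable_fun setT g ->
  (forall x, 0 <= f x) -> (forall x, 0 <= g x) ->
  (forall E, measurable E -> nu E = \int[mu]_(x in E) g x) ->
  \int[nu]_x f x = \int[mu]_x (g x * f x).
Proof.
move=> mf mg f0 g0 nuE.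
pose f_ := nnsfun_approx measurableT mf.
have f_nd x m n : (m <= n)%N -> (f_ m x)%:E <= (f_ n x)%:E.
  by move=> mn; rewrite lee_fin; exact/lefP/nd_nnsfun_approx.
have cvgf x : (fun n => (f_ n x)%:E) @ \oo --> f x.
  by apply: (cvg_nnsfun_approx measurableT mf) => // *; exact: f0.
have cvggf x : (fun n => g x * (f_ n x)%:E) @ \oo --> g x * f x.
  have := g0 x; case: (g x) => [r _|_|//]; first exact: cvgeZl.
  (* Here [g x] is [+oo], and multiplication by it is not continuous at 0. Either some approximant
     is positive, and the products are eventually [+oo], or all of them vanish, and both sides are 0
     because 0 times [+oo] is 0. *)
  have [[N fN]|f_0] := pselect (exists N, (0 < f_ N x)%R).
    have fx : 0 < f x.
      have <- : limn (fun n => (f_ n x)%:E) = f x by exact/cvg_lim.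
      apply: (@lt_le_trans _ _ (f_ N x)%:E); first by rewrite lte_fin.
      apply: lime_ge; first by apply/cvg_ex; exists (f x).
      by near=> n; apply: f_nd; near: n; exact: nbhs_infty_ge.
    rewrite gt0_mulye//; apply: cvg_near_cst; near=> n.
    rewrite gt0_mulye//; apply: (@lt_le_trans _ _ (f_ N x)%:E).
      by rewrite lte_fin.
    by apply: f_nd; near: n; exact: nbhs_infty_ge.
  have f_x0 n : (f_ n x)%:E = 0.
    apply/eqP; rewrite eqe eq_le fun_ge0 andbT leNgt; apply/negP => fn0.
    by apply: f_0; exists n.
  have <- : limn (fun n => (f_ n x)%:E) = f x by exact/cvg_lim.
  under eq_fun do rewrite f_x0 mule0.
  under [X in limn X]eq_fun do rewrite f_x0.
  by rewrite lim_cst// mule0; exact: cvg_cst.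
have mf_ n : measurable_fun setT (fun x => (f_ n x)%:E).
  exact/measurable_EFinP.
transitivity (limn (fun n => \int[nu]_x (f_ n x)%:E)).
  rewrite -monotone_convergence//.
  - by apply: eq_integral => x _; apply/esym/cvg_lim.
  - by move=> n x _; rewrite lee_fin.
  - by move=> x _; exact: f_nd.
transitivity (limn (fun n => \int[mu]_x (g x * (f_ n x)%:E))); last first.
  rewrite -monotone_convergence//.
  - by apply: eq_integral => x _; exact/cvg_lim.
  - by move=> n; exact: emeasurable_funM.
  - by move=> n x _; rewrite mule_ge0// lee_fin.
  - by move=> x _ m n mn; rewrite lee_wpmul2l//; exact: f_nd.
congr (limn _); apply/funext => n.
rewrite [LHS](_ : _ =
    \sum_(r \in range (f_ n)) \int[nu]_x (r * \1_(f_ n @^-1` [set r]) x)%:E).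
  rewrite [RHS](_ : _ = \int[mu]_x
      (\sum_(r \in range (f_ n)) g x * (r * \1_(f_ n @^-1` [set r]) x)%:E)).
    rewrite ge0_integral_fsum//.
    - apply: eq_fsbigr => r /[!inE] -[x _ <-].
      set S := _ @^-1` _.
      have mS : measurable S by exact: measurable_sfunP.
      under [RHS]eq_integral do rewrite EFinM muleCA.
      rewrite (integralZl_indic _ (fun r => f_ n @^-1` [set r]))//; last first.
        by move=> r0; rewrite preimage_nnfun0.
      rewrite integral_indic// setIT ge0_integralZl//.
      + congr (_ * _); rewrite nuE// integral_mkcond.
        by apply: eq_integral => z _; rewrite epatch_indic.
      + by apply: emeasurable_funM => //; exact/measurable_EFinP.
      + by move=> z _; rewrite mule_ge0// lee_fin.
      + by rewrite lee_fin.
    - move=> r; apply: emeasurable_funM => //.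
      exact/measurable_EFinP/measurable_funM.
    - by move=> r x _; rewrite mule_ge0// EFinM nnfun_muleindic_ge0.
  apply: eq_integral => x _.
  rewrite fimfunE -fsumEFin// ge0_mule_fsumr//.
  by move=> r; rewrite EFinM nnfun_muleindic_ge0.
rewrite -ge0_integral_fsum//.
- by apply: eq_integral => x _; rewrite fimfunE -fsumEFin.
- by move=> r; exact/measurable_EFinP/measurable_funM.
- by move=> r x _; rewrite EFinM nnfun_muleindic_ge0.
Unshelve. all: by end_near. Qed.

(** Dynkin's pi-lambda argument inside [K]: as [m1 K] is finite, complements relative to [K] can be
    subtracted. [T] is a sigma-ring so that [restrType X] qualifies, and members of [G] become
    measurable only once cut by [K]. *)
Lemma sigma_ring_measure_unique d (T : sigmaRingType d) (R : realType)
    (m1 m2 : {measure set T -> \bar R}) (G : set (set T)) (K : set T) :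
  setI_closed G -> (forall A, <<s G >> A -> measurable (K `&` A)) ->
  m1 K < +oo -> m1 K = m2 K ->
  (forall A, G A -> m1 (K `&` A) = m2 (K `&` A)) ->
  forall A, <<s G >> A -> m1 (K `&` A) = m2 (K `&` A).
Proof.
move=> GI mG m1K m12K m12G.
have sT : <<s G >> setT.
  have [s0 sC _] := smallest_sigma_algebra setT G.
  by have := sC _ s0; rewrite setD0.
have mK : measurable K.
  by rewrite -(setIT K); exact: mG.
suff sub : <<s G >> `<=`
    [set A | <<s G >> A /\ m1 (K `&` A) = m2 (K `&` A)].
  by move=> A /sub[].
apply: lambda_system_subset => //.
- apply/dynkin_lambda_system; split => /=.
  + by rewrite setIT.
  + move=> A [sA m12A]; split.
      by rewrite -setTD; exact: sigma_algebraCD.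
    have -> : K `&` ~` A = K `\` (K `&` A).
      by rewrite setDIr setDv set0U.
    have finA : m1 (K `&` A) < +oo.
      by apply: le_lt_trans m1K; rewrite le_measure ?inE//; exact: mG.
    have m2K : m2 K < +oo by rewrite -m12K.
    have mKA := mG _ sA.
    rewrite !measureD//.
    by rewrite setIA setIid; congr (_ - _).
  + move=> F tF FP; split.
      by apply: sigma_algebra_bigcup => n; have [] := FP n.
    rewrite setI_bigcupr !measure_bigcup//; last 4 first.
    * by move=> n _; apply: mG; have [] := FP n.
    * exact: trivIset_setIl.
    * by move=> n _; apply: mG; have [] := FP n.
    * exact: trivIset_setIl.
    by apply: eq_eseriesr => n _; have [] := FP n.
- by move=> A GA; split; [exact: sub_sigma_algebra|exact: m12G].
Qed.

End measure_lemmas.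

Lemma disintegration_preimage d d' (T : sigmaRingType d) (Y : measurableType d')
    (R : realType) (D : set T) (h : T -> Y) (mu : {measure set T -> \bar R})
    (k : Y -> {measure set T -> \bar R}) (nu : {measure set Y -> \bar R})
    (A : set T) (B : set Y) :
  measurable D -> (forall C, measurable C -> C `<=` D) ->
  (forall C, measurable C -> measurable (D `&` h @^-1` C)) ->
  (forall y : Y, measurable [set y]) ->
  pushforward_on D mu h = nu ->
  is_disintegration D h mu k -> measurable A -> measurable B ->
  mu (A `&` h @^-1` B) = (\int[nu]_(y in B) k y A)%E.
Proof.
move=> mD subD mh m1 nuE [_ kD +] mA mB; rewrite nuE => muE.
have AE : A `&` h @^-1` B = A `&` (D `&` h @^-1` B).
  by rewrite setIA (setIidl (subD _ mA)).
have mAB : measurable (A `&` h @^-1` B).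
  by rewrite AE; apply: measurableI => //; exact: mh.
rewrite muE// [RHS]integral_mkcond; apply: eq_integral => y _.
have mDy : measurable (D `\` h @^-1` [set y]).
  (* The fibre is first cut by [D]: in a sigma-ring only differences of measurable sets are
     available. *)
  rewrite -[D `\` _]set0U -{1}(setDv D) -setDIr.
  by apply: measurableD => //; exact: mh.
have kD0 (C : set T) : measurable C -> C `<=` D `\` h @^-1` [set y] ->
    k y C = 0%E.
  by move=> mC CD; apply: (subset_measure0 mC mDy CD); exact: kD.
rewrite patchE; case: ifPn => [/[!inE] By|/negP]; last first.
  rewrite inE => nBy; apply: kD0 => // x [Ax hBx]; split; first exact: subD Ax.
  by move=> /= hxy; apply: nBy; rewrite -hxy.
have mAD : measurable (A `\` h @^-1` B).
  rewrite -[A `\` _]set0U -{1}(setDv A) -setDIr.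
  exact: measurableD.
rewrite -[in RHS](setUIDK A (h @^-1` B)) measureU//.
  rewrite [X in (_ + X)%E]kD0 ?adde0// => x [Ax hBx]; split.
    exact: subD Ax.
  by move=> /= hxy; apply: hBx; rewrite /preimage/= hxy.
by rewrite setDE setIACA setICr setI0.
Qed.

(** * Compact sets and Borel traces in metrizable spaces *)

Section metrizable.
Context (R : realType) (T : ptopologicalType).

Lemma metrizable_hausdorff : metrizable R T -> hausdorff_space T.
Proof.
move=> [dist [dist0 dist_eq0 distC dist_tri nbhsP]] p q pq.
apply/dist_eq0/eqP; rewrite eq_le dist0 andbT; apply/ler_addgt0Pr => e e0.
have nb (x : T) : nbhs x [set y | dist x y < e / 2].
  by apply/nbhsP; exists (e / 2) => //; rewrite divr_gt0.
have [z [/= pz qz]] := pq _ _ (nb p) (nb q).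
rewrite add0r (le_trans (dist_tri p z q))// (splitr e) lerD// ltW//.
by rewrite distC.
Qed.

(** Each [K i] is covered by finitely many balls of radius 1/(m+1), for every [m]. An index
    [(i, m, n)] designates the [n]-th ball of that cover. *)
Lemma sigma_compact_countable_base (I : countType) (K : I -> set T) :
  metrizable R T -> (forall i, compact (K i)) ->
  exists B : I * nat * nat -> set T, (forall j, open (B j)) /\
    forall U : set T, open U ->
      U `&` \bigcup_i K i =
      \bigcup_(j in [set j | B j `<=` U]) B j `&` \bigcup_i K i.
Proof.
move=> [dist [dist0 dist_eq0 distC dist_tri nbhsP]] cK.
pose b (m : nat) (c : T) := [set y | dist c y < m.+1%:R^-1].
have bo m c : open (b m c).
  rewrite openE => y /= cy; apply/nbhsP; exists (m.+1%:R^-1 - dist c y).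
    by rewrite subr_gt0.
  move=> z /=; rewrite ltrBrDl => yz; rewrite /b/=.
  exact: le_lt_trans (dist_tri c y z) yz.
have /choice[C CP] : forall im : I * nat, exists C : seq T,
    K im.1 `<=` \bigcup_(c in [set` C]) b im.2 c.
  move=> [i m] /=; have := cK i; rewrite compact_cover => cKi.
  have [|x _|C _ KC] := cKi T setT (b m); last by exists (finmap.enum_fset C).
    by move=> c _; exact: bo.
  by exists x => //; rewrite /b/= (dist_eq0 x x).2.
(* Positions past the end of the list give a ball around [point]. It is harmless: it is open, and
   only the balls included in [U] enter the union. *)
exists (fun j => b j.1.2 (nth point (C j.1) j.2)).
split=> [j|U oU]; first exact: bo.
apply/seteqP; split=> x [xU [i _ Kix]]; (split; last by exists i); last first.
  by have [j jU jx] := xU; exact: jU.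
have /nbhsP[e e0 eU] : nbhs x U by exact: open_nbhs_nbhs.
(* With radius below e/2, a ball of the cover that contains [x] stays within distance [e] of [x]. *)
have [m me] : exists m : nat, m.+1%:R^-1 < e / 2.
  have e20 : 0 < e / 2 by rewrite divr_gt0.
  exists (Num.truncn (e / 2)^-1).
  by rewrite invf_plt ?posrE// truncnS_gt.
have [c Cc cx] := CP (i, m) x Kix.
exists ((i, m), index c (C (i, m))); last by rewrite /= nth_index.
rewrite /= nth_index// => z cz; apply: eU => /=.
rewrite (le_lt_trans (dist_tri x c z))// (splitr e) ltrD//.
  by rewrite distC (lt_trans cx).
exact: lt_trans cz me.
Qed.

End metrizable.

Lemma metrizable_compact_measurable (R : realType) (T : ptopologicalType)
  (K : set T) : metrizable R T -> compact K -> measurable (K : set (borel T)).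
Proof.
move=> mT cK; rewrite -[K]setCK; apply: measurableC; apply: sub_sigma_algebra.
rewrite /= openC; apply: compact_closed => //.
exact: metrizable_hausdorff mT.
Qed.

(** [G s] is the intersection of the base sets listed in [s], so concatenation of lists gives
    closure under intersection. The sets having the same trace as some member of <<s range G>> form
    a sigma-algebra, and it contains the open sets. *)
Lemma sigma_compact_borel_trace (R : realType) (T : ptopologicalType)
    (I : countType) (K : I -> set T) :
  metrizable R T -> (forall i, compact (K i)) ->
  exists G : seq (I * nat * nat) -> set T,
    [/\ forall s, measurable (G s : set (borel T)), setI_closed (range G) &
      forall A : set (borel T), measurable A -> exists2 A' : set T,
        <<s range G >> A' & A `&` \bigcup_i K i = A' `&` \bigcup_i K i].
Proof.
move=> mT cK; have [B [oB BP]] := sigma_compact_countable_base mT cK.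
pose G (s : seq (I * nat * nat)) := [set x | forall j, j \in s -> B j x].
have G1 j : G [:: j] = B j.
  apply/seteqP; split=> x /=; first by apply; rewrite inE.
  by move=> Bjx i; rewrite inE => /eqP ->.
have GU s t : G (s ++ t) = G s `&` G t.
  apply/seteqP; split=> x /=.
    by move=> st; split=> j js; apply: st; rewrite mem_cat js ?orbT.
  by move=> [Gs Gt] j; rewrite mem_cat => /orP[/Gs|/Gt].
have [s0 sD sU] := @smallest_sigma_algebra T setT (range G).
exists G; split.
- elim=> [|j s mGs].
    by rewrite (_ : G [::] = setT)//; apply/seteqP; split.
  rewrite -cat1s GU G1; apply: measurableI => //.
  exact: sub_sigma_algebra.
- by move=> _ _ [s _ <-] [t _ <-]; exists (s ++ t); rewrite ?GU.
- set L := \bigcup_i K i.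
  apply: smallest_sub.
    split.
    + by exists set0.
    + move=> A [A' sA' AA']; exists (setT `\` A'); first exact: sD.
      have CE (S : set T) : (setT `\` S) `&` L = L `\` (S `&` L).
        by rewrite setDIr setDv setU0 setTD setIC.
      by rewrite !CE AA'.
    + move=> F FP; have /choice[F' F'P] : forall n, exists A',
          <<s range G >> A' /\ F n `&` L = A' `&` L.
        by move=> n; have [A'] := FP n; exists A'.
      exists (\bigcup_n F' n); first by apply: sU => n; have [] := F'P n.
      by rewrite !setI_bigcupl; apply: eq_bigcupr => n _; have [] := F'P n.
  move=> U oU; exists (\bigcup_(j in [set j | B j `<=` U]) B j); last exact: BP.
  (* The union over the base sets inside [U] is turned into a union of a sequence; numbers that code
     no index contribute the empty set. *)
  pose F n := oapp (fun j => [set x | B j `<=` U /\ B j x]) set0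
    (unpickle n : option (I * nat * nat)).
  rewrite (_ : \bigcup_(j in _) _ = \bigcup_n F n); last first.
    apply/seteqP; split=> x [j jU jx].
      by exists (pickle j) => //; rewrite /F pickleK.
    by move: jx; rewrite /F; case: unpickle => //= i [iU ix]; exists i.
  apply: sU => n; rewrite /F; case: unpickle => //= j.
  have [BjU|nBjU] := pselect (B j `<=` U).
    rewrite (_ : [set _ | _] = B j); last by apply/seteqP; split=> x //= [].
    by rewrite -G1; apply: sub_sigma_algebra; exists [:: j].
  by rewrite (_ : [set _ | _] = set0)//; apply/seteqP; split=> x //= [].
Qed.

(** Inner regularity fills each [F n], of finite measure, by compact sets up to 1/(m+1); letting [m]
    grow, their union misses only a null part of [F n]. *)
Lemma radon_sigma_finite_sigma_compact (R : realType) (T : ptopologicalType)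
    (mu : {measure set (borel T) -> \bar R}) :
  metrizable R T -> radon mu -> sigma_finite setT mu ->
  exists2 K : nat * nat -> set T, forall i, compact (K i) &
    mu (~` \bigcup_i K i) = 0%E.
Proof.
move=> mT [_ regmu] [F FT Ffin].
have /choice[K KP] : forall nm : nat * nat, exists K : set T,
    [/\ compact K, K `<=` F nm.1 & (mu (F nm.1 `\` K) <= nm.2.+1%:R^-1%:E)%E].
  move=> [n m] /=; have [mF muF] := Ffin n.
  have muFfin : mu (F n) \is a fin_num by rewrite ge0_fin_numE.
  have m0 : 0 < m.+1%:R^-1 :> R by rewrite invr_gt0.
  move: muFfin; rewrite (regmu _ mF) => muFfin.
  have [_ [K [cK KF] <-]] := ub_ereal_sup_adherent m0 muFfin.
  rewrite -(regmu _ mF) => muK; exists K; split=> //.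
  have mK : measurable (K : set (borel T)).
    exact: metrizable_compact_measurable mT cK.
  rewrite measureD// (setIidr KF) leeBlDr//; last first.
    by rewrite ge0_fin_numE// (le_lt_trans _ muF)// le_measure ?inE.
  by rewrite addeC -leeBlDr//; exact: ltW.
exists K => [i|]; first by have [] := KP i.
have mK i : measurable (K i : set (borel T)).
  by have [cK _ _] := KP i; exact: metrizable_compact_measurable mT cK.
have mL : measurable (\bigcup_i K i : set (borel T)).
  exact: countable_bigcupT_measurable.
have mu0 n : mu (F n `\` \bigcup_i K i) = 0%E.
  have mFL : measurable (F n `\` \bigcup_i K i).
    by apply: measurableD => //; exact: (Ffin n).1.
  apply/eqP; rewrite -measure_le0; apply/lee_addgt0Pr => e e0.
  rewrite add0e.
  have me : (Num.truncn e^-1).+1%:R^-1 <= e.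
    by rewrite ltW// invf_plt ?posrE// truncnS_gt.
  have [_ _ muK] := KP (n, Num.truncn e^-1).
  apply: le_trans (le_trans muK _); last by rewrite lee_fin.
  apply: le_measure; rewrite ?inE//.
    by apply: measurableD => //; exact: (Ffin n).1.
  by apply: setDS; exact: bigcup_sup.
apply/(@negligibleP _ _ _ mu); first exact: measurableC.
apply: (@negligibleS _ _ _ mu (\bigcup_n (F n `\` \bigcup_i K i))).
  by rewrite -setD_bigcupl -FT setTD.
by apply: negligible_bigcup => n; exists (F n `\` \bigcup_i K i); split;
  [apply: measurableD => //; exact: (Ffin n).1|exact: mu0|].
Qed.

(** * Comparison of the two disintegrations *)

Theorem lemma2p10 (R : realType) (T : ptopologicalType) (d : measure_display)
    (Y : measurableType d) (h : borel T -> Y)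
    (mu : {measure set (borel T) -> \bar R}) (X : set (borel T))
    (muh : Y -> {measure set (borel T) -> \bar R})
    (muXh : Y -> {measure set (restrType X) -> \bar R}) :
  metrizable R T ->
  countably_generated Y ->
  (forall y : Y, measurable [set y]) ->
  measurable_fun [set: borel T] h ->
  radon mu ->
  sigma_finite [set: borel T] mu ->
  sigma_finite [set: Y] (pushforward mu h) ->
  measurable X ->
  is_disintegration [set: borel T] h mu muh ->
  is_disintegration (X : set (restrType X)) (h : restrType X -> Y)
    (restrict_measure mu (X := X)) muXh ->
  {ae pushforward mu h, forall y : Y,
    forall A : set (restrType X), measurable A ->
      restrict_measure (muh y) A = (muh y X * muXh y A)%E}.
Proof.
move=> mT _ m1 mh radmu sfmu sfnu mX dis disX.
have [K cK] := radon_sigma_finite_sigma_compact mT radmu sfmu.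
have [G [mG GI GP]] := sigma_compact_borel_trace mT cK.
have mL : measurable (\bigcup_i K i : set (borel T)).
  have mK i : measurable (K i : set (borel T)).
    exact: metrizable_compact_measurable mT (cK i).
  exact: countable_bigcupT_measurable.
set L := \bigcup_i K i in GP mL * => muL0.
have [nu nuE] : exists nu : {measure set Y -> \bar R}, pushforward mu h = nu.
  by exists (measure_function_pushforward__canonical__measure_function_Measure
    mu mh).
have [nuX nuXE] : exists nuX : {measure set Y -> \bar R},
    pushforward (mrestr mu mX) h = nuX.
  by exists (measure_function_pushforward__canonical__measure_function_Measure
    (mrestr mu mX) mh).
rewrite nuE in sfnu *; have [F FT Ffin] := sfnu.
have mhE E : measurable E -> measurable (h @^-1` E).
  by move=> mE; rewrite -[_ @^-1` _]setTI; exact: mh.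
have intE A E : measurable A -> measurable E ->
    mu (A `&` h @^-1` E) = (\int[nu]_(y in E) muh y A)%E.
  move=> mA mE; apply: (disintegration_preimage _ _ _ m1 _ dis) => //.
    by move=> C mC; rewrite setTI; exact: mhE.
  by rewrite -nuE; apply/funext => B; rewrite /pushforward_on setTI.
have intXE (A : set (restrType X)) E : measurable A -> measurable E ->
    mu (A `&` h @^-1` E) = (\int[nuX]_(y in E) muXh y A)%E.
  move=> mA mE; apply: (disintegration_preimage _ _ _ m1 _ disX) => //.
  - by split.
  - by move=> C [].
  - by move=> C mC; split=> //; apply: measurableI => //; exact: mhE.
  - rewrite -nuXE; apply/funext => B.
    by rewrite /pushforward_on /pushforward /mrestr setIC.
have mmuh A : measurable A -> measurable_fun setT (muh ^~ A).
  by case: dis => + _ _; exact.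
have mmuXh (A : set (restrType X)) :
    measurable A -> measurable_fun setT (muXh ^~ A).
  by case: disX => + _ _; exact.
(* The values [muh y A] are determined almost everywhere by their integrals, which are finite over
   [F n] since they are at most [nu (F n)]. *)
have ae_muh A g : measurable A -> measurable_fun setT g ->
    (forall E, measurable E ->
      mu (A `&` h @^-1` E) = (\int[nu]_(y in E) g y)%E) ->
    \forall y \ae nu, muh y A = g y.
  move=> mA mg Ag; apply: (ge0_integral_ae_eq (esym FT)) => //.
  - by move=> n; have [] := Ffin n.
  - exact: mmuh.
  - move=> n; have [mF nuF] := Ffin n; rewrite -intE//.
    apply: le_lt_trans nuF; rewrite -nuE; apply: le_measure; rewrite ?inE//.
      by apply: measurableI => //; exact: mhE.
    exact: mhE.
  - by move=> E mE; rewrite -intE// Ag.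
have aeA (A : set (restrType X)) : measurable A ->
    \forall y \ae nu, muh y A = (muh y X * muXh y A)%E.
  move=> mA; have [mA' AX] := mA; apply: ae_muh => //.
    by apply: emeasurable_funM; [exact: mmuh|exact: mmuXh].
  move=> E mE; rewrite intXE// integral_mkcond [RHS]integral_mkcond.
  (* By [intE] at [X], the measure [nuX] has density [muh y X] with respect to [nu]. *)
  rewrite (@ge0_integral_density _ _ _ nu nuX _ (muh ^~ X)).
  - by apply: eq_integral => y _; rewrite !patchE; case: ifP; rewrite ?mule0.
  - by apply/(measurable_restrictT _ mE)/measurable_funTS; exact: mmuXh.
  - exact: mmuh.
  - by move=> y; rewrite patchE; case: ifP.
  - by [].
  - by move=> B mB; rewrite -intE// -nuXE /pushforward /mrestr setIC.
have ae1 : \forall y \ae nu, muh y setT = 1%E.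
  apply: ae_muh => // E mE.
  by rewrite setTI integral_cst// mul1e -nuE.
have ae0 : \forall y \ae nu, muh y (~` L) = 0%E.
  apply: ae_muh => //; first exact: measurableC.
  move=> E mE; rewrite integral0; apply: subset_measure0 muL0.
  - by apply: measurableI; [exact: measurableC|exact: mhE].
  - exact: measurableC.
  - exact: subIsetl.
have mXL (A : set (borel T)) : measurable A ->
    measurable (X `&` L `&` A : set (restrType X)).
  by move=> mA; split; [do 2 apply: measurableI => //|move=> x [[]]].
have aeG : \forall y \ae nu, forall s,
    muh y (X `&` L `&` G s) = (muh y X * muXh y (X `&` L `&` G s))%E.
  by apply: ae_forall_countable => s; apply: aeA; exact: mXL.
have mXL0 : measurable (X `&` L : set (restrType X)).
  by rewrite -[X `&` L]setIT; exact: mXL.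
have mXD : measurable (X `\` L : set (restrType X)).
  by split; [exact: measurableD|exact: subDsetl].
have aeXL := aeA _ mXL0; have aeXD := aeA _ mXD.
(* All almost-sure properties needed are now gathered, none depending on the set [A] introduced
   below; [y] is fixed outside their null sets. *)
near=> y.
have muhT : muh y setT = 1%E by near: y.
have muhL : muh y (~` L) = 0%E by near: y.
have muhG : forall s,
    muh y (X `&` L `&` G s) = (muh y X * muXh y (X `&` L `&` G s))%E by near: y.
have muhXL : muh y (X `&` L) = (muh y X * muXh y (X `&` L))%E by near: y.
have muhXD : muh y (X `\` L) = (muh y X * muXh y (X `\` L))%E by near: y.
move=> A mA.
have [mA' AX] := mA; rewrite /restrict_measure.
have muh_le1 (B : set (borel T)) : measurable B -> (muh y B <= 1)%E.
  by move=> mB; rewrite -muhT; apply: le_measure; rewrite ?inE.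
have muh_fin : muh y X \is a fin_num.
  by rewrite ge0_fin_numE// (le_lt_trans (muh_le1 _ mX))// ltry.
have XD0 : muh y (X `\` L) = 0%E.
  apply: subset_measure0 muhL; [exact: measurableD|exact: measurableC|].
  by move=> x [].
have [muhX0|muhX0] := eqVneq (muh y X) 0%E.
  by rewrite muhX0 mul0e; exact: subset_measure0 muhX0.
have r0 : 0 <= fine (muh y X) by exact: fine_ge0.
(* The right-hand side as a measure; [mscale] takes a finite scalar, and [muh y X] is at most 1. *)
pose m2 : {measure set (restrType X) -> \bar R} := mscale (NngNum r0) (muXh y).
pose muhX : {measure set (restrType X) -> \bar R} :=
  restrict_measure (muh y) (X := X).
have m2E B : m2 B = (muh y X * muXh y B)%E.
  by rewrite /m2/= /mscale/= fineK.
have XL_unique B : <<s range G >> B ->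
    muh y (X `&` L `&` B) = m2 (X `&` L `&` B).
  apply: (@sigma_ring_measure_unique _ (restrType X) R muhX m2 (range G)
    (X `&` L)) => //.
  - move=> C sC; apply: mXL; move: C sC; apply: smallest_sub.
      exact: (@sigma_algebra_measurable _ (borel T)).
    by move=> _ [s _ <-]; exact: mG.
  - by rewrite (le_lt_trans (muh_le1 _ _)) ?ltry//; exact: measurableI.
  - by rewrite m2E.
  - by move=> _ [s _ <-]; rewrite m2E; exact: muhG.
(* On [L], the set [A] may be replaced by a set generated by [G], to which [XL_unique] applies. *)
have [A' sA' AA'] := GP A mA'.
have XLA : X `&` L `&` A' = A `&` L.
  by rewrite -setIA [L `&` _]setIC -AA' setIA (setIidr AX).
have mAL : measurable (A `&` L : set (restrType X)).
  by split; [exact: measurableI|move=> x [/AX]].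
have mAD : measurable (A `\` L : set (restrType X)).
  by split; [exact: measurableD|move=> x [/AX]].
have dAL : A `&` L `&` (A `\` L) = set0.
  by rewrite setDE setIACA setICr setI0.
(* Off [L] both measures vanish: [m2] agrees with [muh y] on X [\] L by [muhXD], and [muh y] is null
   there. *)
have m2D : m2 (A `\` L) = 0%E.
  apply: (subset_measure0 mAD mXD); first exact: setSD.
  by apply: etrans (m2E _) _; rewrite -muhXD.
have muhD : muh y (A `\` L) = 0%E.
  by apply: (subset_measure0 _ _ _ XD0); [case: mAD|case: mXD|exact: setSD].
rewrite -m2E -(setUIDK A L) measureU//; [|by case: mAL|by case: mAD].
rewrite [RHS]measureU//; congr (_ + _)%E.
  by rewrite -XLA; exact: XL_unique.
exact: etrans muhD (esym m2D).
Unshelve. all: by end_near. Qed.
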